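(* Let $M$ be an $N$-function and let $\phi:[1,\infty)\times(0,\infty)\to(0,\infty)$, $(\lambda,u)\mapsto\phi(\lambda,u)$, be a positive function that is nondecreasing in the first argument and nondecreasing in the second argument, such that $$M(\lambda u)\ \ge\ \phi(\lambda,u)\, M(u)\qquad\text{for all } \lambda\ge 1 \text{ and all } u>0.$$ Then for every real $R>1$ and every $x\in L_M$ with $\|x\|\ge R$, $$\mathcal{M}(x)\ \ge\ \phi\left(\frac{\|x\|}{R},\ \frac{R-1}{R\,\|\mathbf{1}\|}\right),$$ where $\mathbf{1}$ is the function on $\Omega$ identically equal to $1$.
   Context: $(\Omega,\mathfrak{A},\mu)$ is a set with a $\sigma$-algebra and a $\sigma$-additive measure $\mu$ that is finite ($\mu(\Omega)<\infty$) and continuous (every set of positive measure can be divided into two sets of equal measure). An $N$-function is a convex function $M:[0,\infty)\to[0,\infty)$ with $\lim_{u\to0}M(u)/u=0$ and $\lim_{u\to\infty}M(u)/u=\infty$. The modular generated by $M$ is $\mathcal{M}(x)=\int_\Omega M(|x(\omega)|)\,d\mu(\omega)\in[0,\infty]$ for measurable $x$ on $\Omega$. The Orlicz space $L_M$ is the set of measurable functions $x$ for which $\mathcal{M}(x/\lambda)<\infty$ for some $\lambda>0$. The norm $\|\cdot\|$ is the Luxemburg norm $\|x\|=\inf\{\lambda>0:\ \mathcal{M}(x/\lambda)\le 1\}$.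
   Formalization: The N-function is additionally required to satisfy M(0)=0 (standard, but not implied by convexity and the two limits); without it the claim fails, e.g. M(u)=u² for u>0, M(0)=0.99 on Ω=[0,2], x the indicator of [0,1], φ=λ², R=2. *)

(* Defs.v *)
From HB Require Import structures.
From mathcomp Require Import all_boot all_order all_algebra.
From mathcomp Require Import all_classical all_reals all_analysis.
Import Order.TTheory GRing.Theory Num.Theory.
Import numFieldNormedType.Exports.

Set Implicit Arguments.
Unset Strict Implicit.
Unset Printing Implicit Defensive.

Local Open Scope classical_set_scope.
Local Open Scope ring_scope.

(* A function on [0, +oo[ is represented by a total function R -> R whose
   values at negative arguments are irrelevant.  [M 0 = 0] is implicit in the
   usual definition: convexity on [0, +oo[ and the limit at 0+ only give
   [M u --> 0] as [u --> 0+], and without [M 0 = 0] the Luxemburg functional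
   is not a norm. *)
Record N_function (R : realType) (M : R -> R) : Prop := {
  N_function0 : M 0 = 0 ;
  N_function_ge0 : forall u, 0 <= u -> 0 <= M u ;
  N_function_convex : convex_function (`[0, +oo[%classic : set R) M ;
  N_function_cvg0 : M u / u @[u --> 0^'+] --> 0 ;
  N_function_cvgy : M u / u @[u --> +oo] --> +oo }.

Definition continuous_measure (R : realType) (d : measure_display)
    (T : measurableType d) (mu : {measure set T -> \bar R}) : Prop :=
  forall A : set T, measurable A -> (0 < mu A)%E ->
    exists B : set T,
      [/\ measurable B, B `<=` A & mu B = mu (A `\` B)].

Section orlicz.
Context (R : realType) (d : measure_display) (T : measurableType d).
Variables (mu : {measure set T -> \bar R}) (M : R -> R).

Definition modular (x : T -> R) : \bar R := (\int[mu]_w (M `|x w|)%:E)%E.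

Definition orlicz_space : set (T -> R) :=
  [set x : T -> R | measurable_fun [set: T] x /\
    exists l : R, 0 < l /\ (modular (fun w => (x w / l)%R) < +oo)%E].

(* The set below is nonempty for [x] in [orlicz_space] when [M] is an
   N-function; outside of that space [inf] may take its default value 0. *)
Definition luxemburg_norm (x : T -> R) : R :=
  inf [set l : R | 0 < l /\ (modular (fun w => (x w / l)%R) <= 1)%E].

End orlicz.

(* Main.v *)
Require Import Defs.
From HB Require Import structures.
From mathcomp Require Import all_boot all_order all_algebra.
From mathcomp Require Import all_classical all_reals all_analysis.
From mathcomp Require Import measurable_realfun lra.
Import Order.TTheory GRing.Theory Num.Theory.
Import numFieldNormedType.Exports.

Local Open Scope classical_set_scope.
Local Open Scope ring_scope.

(** Put [N = ||x||], [c = ||1||], [l = N / r], [u = (r - 1) / (r * c)], and let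
    [y = x / l], so that [||y|| = r].  Cut [y] at height [u]: let [y1] be [y]
    where [u <= `|y|] and [0] elsewhere.

    The part cut off is bounded by [u], hence has norm at most
    [u * c = (r - 1) / r < r - 1].  By the triangle inequality [||y1|| > 1],
    which forces the modular of [y1] to exceed [1].  This step is
    [modular_truncation_gt1].  On the other hand, where [y1] does not vanish
    the growth hypothesis gives
    [M `|x| = M (l * `|y|) >= phi l `|y| * M `|y| >= phi l u * M `|y1|],
    and elsewhere the bound [M `|x| >= 0 = phi l u * M `|y1|] is trivial.
    Integrating, the modular of [x] is at least [phi l u] times the modular of
    [y1], hence at least [phi l u].

    The value [u] is positive only if [c > 0].  This holds because
    [||x|| >= r > 0] makes the measure nonzero and [M] is unbounded; that
    [M u / u] tends to [0] at [0] makes the infimum defining [c] an infimum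
    over a nonempty set. *)

(** * N-functions *)

Section N_function_theory.
Set Implicit Arguments.
Unset Strict Implicit.
Context (R : realType) (M : R -> R) (M_N : N_function M).

(** Convexity between [0] and [u], using [M 0 = 0].  Monotonicity follows from
    this, and the triangle inequality below takes nothing else from
    convexity. *)
Lemma N_function_le_scale (a u : R) :
  0 <= a -> a <= 1 -> 0 <= u -> M (a * u) <= a * M u.
Proof.
move=> a0 a1 u0.
have in_u : u \in (`[0, +oo[%classic : set R) by rewrite inE/= in_itv/= u0.
have in_0 : 0 \in (`[0, +oo[%classic : set R) by rewrite inE/= in_itv/= lexx.
have : M (a * u + (1 - a) * 0) <= a * M u + (1 - a) * M 0.
  exact: (N_function_convex M_N (Itv01 a0 a1) in_u in_0).
by rewrite (N_function0 M_N) !mulr0 !addr0.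
Qed.

Lemma N_function_le (u v : R) : 0 <= u -> u <= v -> M u <= M v.
Proof.
move=> u0 uv.
have [v0|v0] := eqVneq v 0.
  by rewrite (_ : u = v)//; apply/eqP; rewrite eq_le uv v0 u0.
have v_gt0 : 0 < v by rewrite lt_neqAle eq_sym v0 (le_trans u0).
have a1 : u / v <= 1 by rewrite ler_pdivrMr// mul1r.
have a0 : 0 <= u / v by rewrite divr_ge0// ltW.
have := N_function_le_scale a0 a1 (ltW v_gt0).
rewrite divfK// => /le_trans; apply.
by rewrite ler_piMl// (N_function_ge0 M_N)// ltW.
Qed.

Lemma measurable_N_function_norm d (T : measurableType d) (x : T -> R) :
  measurable_fun [set: T] x ->
  measurable_fun [set: T] (fun w => (M `|x w|)%:E : \bar R).
Proof.
move=> mx; apply/measurable_EFinP.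
(* [M] is arbitrary on negative reals; composing with [max 0] makes it
   monotone on the whole line without changing it at norms. *)
pose M0 (u : R) := M (Num.max 0 u).
have mM0 : measurable_fun setT M0.
  apply: nondecreasing_measurable => // u v uv.
  by apply: N_function_le; [rewrite le_max lexx|rewrite le_max2].
rewrite (_ : (fun w => M `|x w|) = M0 \o (fun w => `|x w|)); last first.
  by apply/funext => w /=; rewrite /M0 max_r.
by apply: measurableT_comp => //; exact: measurableT_comp.
Qed.

Lemma N_function_small (e : R) : 0 < e -> exists2 u, 0 < u & M u <= e.
Proof.
move=> e0.
have /cvgr_lt /(_ 1 ltr01) h := N_function_cvg0 M_N.
suff : \forall u \near 0^'+, [/\ 0 < u, u < e & M u / u < 1 :> R].
  move=> /filter_ex[u [u0 ue]]; rewrite ltr_pdivrMr// mul1r => Mu.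
  by exists u => //; rewrite ltW// (lt_trans Mu).
near=> u; split => //; near: u => //.
Unshelve. all: by end_near. Qed.

Lemma N_function_large (B : R) : exists2 u, 0 < u & B <= M u.
Proof.
have /cvgryPge /(_ `|B|) h := N_function_cvgy M_N.
suff : \forall u \near +oo%R, [/\ 1 <= u & `|B| <= M u / u :> R].
  move=> /filter_ex[u [u1]].
  have u0 : 0 < u by rewrite (lt_le_trans ltr01).
  rewrite ler_pdivlMr// => BM; exists u => //.
  by rewrite (le_trans (ler_norm B))// (le_trans _ BM)// ler_peMr.
near=> u; split; near: u => //.
by apply: nbhs_pinfty_ge; rewrite num_real.
Unshelve. all: by end_near. Qed.

End N_function_theory.

(** * The modular and the Luxemburg norm *)

Section luxemburg_theory.
Set Implicit Arguments.
Unset Strict Implicit.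
Context (R : realType) (d : measure_display) (T : measurableType d).
Context (mu : {finite_measure set T -> \bar R}).
Context (M : R -> R) (M_N : N_function M).

Lemma modular_cst (a : R) :
  modular mu M (cst a) = ((M `|a|)%:E * mu setT)%E.
Proof. exact: (integral_cst mu measurableT (M `|a|)%:E). Qed.

Lemma luxemburg_norm_le (x : T -> R) (l : R) : 0 < l ->
  (modular mu M (fun w => (x w / l)%R) <= 1)%E -> luxemburg_norm mu M x <= l.
Proof.
move=> l0 xl; apply: ge_inf => //.
by exists 0 => k [k0 _]; exact: ltW.
Qed.

(** Over a null space every modular is [0], so every positive number is
    admissible in the infimum, in particular half of the norm. *)
Lemma luxemburg_norm_gt0_measure (x : T -> R) : measurable_fun setT x ->
  0 < luxemburg_norm mu M x -> (0 < mu setT)%E.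
Proof.
move=> mx N0; rewrite lt_neqAle measure_ge0 andbT; apply/eqP => mu0.
suff : luxemburg_norm mu M x <= luxemburg_norm mu M x / 2 by lra.
apply: luxemburg_norm_le; first by rewrite divr_gt0.
have mxl := measurable_N_function_norm M_N
  (measurable_funM mx (measurable_cst (luxemburg_norm mu M x / 2)^-1)).
by rewrite /modular null_set_integral.
Qed.

Lemma finite_measure_posE : (0 < mu setT)%E ->
  exists2 m : R, 0 < m & mu setT = m%:E.
Proof.
move=> mu0; exists (fine (mu setT)); last first.
  by rewrite fineK// fin_num_measure.
by rewrite fine_gt0// mu0 ltey_eq fin_num_measure.
Qed.

Lemma luxemburg_norm_cst1_nonempty : (0 < mu setT)%E ->
  [set l : R | 0 < l /\ (modular mu M (fun w => (cst 1 w / l)%R) <= 1)%E]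
    !=set0.
Proof.
move=> /finite_measure_posE[m m0 mE].
have [u u0 Mu] : exists2 u, 0 < u & M u <= m^-1.
  by apply: N_function_small; rewrite ?invr_gt0.
exists u^-1; split; first by rewrite invr_gt0.
rewrite /= mul1r invrK modular_cst mE gtr0_norm// -EFinM lee_fin.
by rewrite -ler_pdivlMr// mul1r.
Qed.

(** At [l < u^-1] the modular of [1 / l] is at least [M u] times the total mass,
    which exceeds [1] once [M u] exceeds the inverse of that mass. *)
Lemma luxemburg_norm_cst1_gt0 : (0 < mu setT)%E ->
  0 < luxemburg_norm mu M (cst 1).
Proof.
move=> mu0; have [m m0 mE] := finite_measure_posE mu0.
have [u u0 Mu] := N_function_large M_N (m^-1 + 1).
apply: (@lt_le_trans _ _ u^-1); first by rewrite invr_gt0.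
apply: lb_le_inf; first exact: luxemburg_norm_cst1_nonempty.
move=> l [l0]; rewrite /= mul1r modular_cst mE -EFinM lee_fin.
rewrite gtr0_norm ?invr_gt0// => Ml; rewrite leNgt; apply/negP => lu.
have : M u <= M l^-1.
  apply: N_function_le => //; first exact: ltW.
  by rewrite -[u]invrK lef_pV2 ?posrE ?invr_gt0// ltW.
move=> /(le_trans Mu); rewrite -(ler_pM2r m0) mulrDl mulVf ?gt_eqF// mul1r.
by move=> /le_trans /(_ Ml); rewrite gerDl leNgt m0.
Qed.

Definition truncation (u : R) (y : T -> R) : T -> R :=
  fun w => if u <= `|y w| then y w else 0.

Lemma measurable_truncation (u : R) (y : T -> R) :
  measurable_fun setT y -> measurable_fun setT (truncation u y).
Proof.
move=> my; apply: measurable_fun_ifT => //.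
by apply: measurable_fun_ler => //; exact: measurableT_comp.
Qed.

(** The triangle inequality for the splitting of [y] at height [u].  With
    [t = (1 + u * l)^-1], the function [t * y] is, at each point, at most
    [t * `|y1|] or at most [(1 - t) * l^-1] in absolute value, because
    [t * u = (1 - t) * l^-1].  So [M (t * `|y|)] is at most the sum
    [t * M `|y1| + (1 - t) * M l^-1], whose integral is at most
    [t + (1 - t) = 1]. *)
Lemma modular_truncation_le1 (u l : R) (y : T -> R) :
  measurable_fun setT y -> 0 < u -> 0 < l ->
  (modular mu M (truncation u y) <= 1)%E ->
  (modular mu M (cst l^-1%R) <= 1)%E ->
  (modular mu M (fun w => (y w / (1 + u * l))%R) <= 1)%E.
Proof.
move=> my u0 l0 y1 l1.
have ul0 : 0 < u * l by rewrite mulr_gt0.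
have k0 : 0 < 1 + u * l by lra.
set t := (1 + u * l)^-1.
have t0 : 0 < t by rewrite invr_gt0.
have t1 : t <= 1 by rewrite invf_le1//; lra.
have tu : t * u = (1 - t) * l^-1.
  have tk : t * (1 + u * l) = 1 by rewrite mulVf// gt_eqF.
  by apply: (mulIf (lt0r_neq0 l0)); rewrite divfK ?gt_eqF//; lra.
have t'0 : 0 <= 1 - t by lra.
have t'1 : 1 - t <= 1 by lra.
have li0 : 0 <= l^-1 by rewrite invr_ge0 ltW.
have M0 (a : R) : 0 <= M `|a| by exact: (N_function_ge0 M_N).
have my1 := measurable_N_function_norm M_N (measurable_truncation u my).
have ml := measurable_N_function_norm M_N
  (measurable_cst l^-1 : measurable_fun [set: T] _).
have le_pt w : (M `|y w * t|) <=
    t * M `|truncation u y w| + (1 - t) * M `|l^-1|.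
  rewrite normrM (gtr0_norm t0) (ger0_norm li0) mulrC /truncation.
  case: ifPn => [_|]; last rewrite -ltNge => /ltW yu.
    apply: (le_trans (N_function_le_scale M_N (ltW t0) t1 (normr_ge0 _))).
    by rewrite lerDl mulr_ge0// (N_function_ge0 M_N).
  rewrite normr0 (N_function0 M_N) mulr0 add0r.
  apply: le_trans (N_function_le_scale M_N t'0 t'1 li0).
  rewrite -tu; apply: N_function_le => //; first by rewrite mulr_ge0// ltW.
  by rewrite ler_pM2l.
apply: (@le_trans _ _ (\int[mu]_w
    (t%:E * (M `|truncation u y w|)%:E + (1 - t)%:E * (M `|l^-1|)%:E))%E).
  apply: ge0_le_integral => //.
  - by move=> w _; rewrite lee_fin.
  - by apply: measurable_N_function_norm => //; exact: measurable_funM.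
  - by apply: emeasurable_funD; exact: measurable_funeM.
  - by move=> w _; rewrite -!EFinM -EFinD lee_fin.
rewrite ge0_integralD//; last 3 first.
- by move=> w _; rewrite mule_ge0// lee_fin// ltW.
- exact: measurable_funeM.
- by move=> w _; rewrite mule_ge0// lee_fin.
rewrite !ge0_integralZl//; last 3 first.
- by move=> w _; rewrite lee_fin.
- by move=> w _; rewrite lee_fin.
- by rewrite lee_fin ltW.
apply: (@le_trans _ _ (t%:E * 1 + (1 - t)%:E * 1)%E).
  by apply: leeD; apply: lee_wpmul2l => //; rewrite lee_fin// ltW.
by rewrite !mule1 -EFinD lee_fin; lra.
Qed.

(** A modular of [y1] at most [1] would make [||y1|| <= 1], and the triangle
    inequality would bound [||y||] by [1 + u * ||1||], for [y = x / k].  The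
    infimum defining [||1||] need not be known to be attained: the bound holds
    for every admissible [l] in place of [||1||]. *)
Lemma modular_truncation_gt1 (u k : R) (x : T -> R) :
  measurable_fun setT x -> (0 < mu setT)%E -> 0 < u -> 0 < k ->
  k * (1 + u * luxemburg_norm mu M (cst 1)) < luxemburg_norm mu M x ->
  (1 < modular mu M (truncation u (fun w => (x w / k)%R)))%E.
Proof.
move=> mx mu0 u0 k0 Nx; rewrite ltNge; apply/negP => y1.
have : (luxemburg_norm mu M x / k - 1) / u <= luxemburg_norm mu M (cst 1).
  apply: lb_le_inf; first exact: luxemburg_norm_cst1_nonempty.
  move=> l [l0]; rewrite /= mul1r => l1.
  have my : measurable_fun setT (fun w => x w / k) by exact: measurable_funM.
  have h : luxemburg_norm mu M x <= k * (1 + u * l).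
    apply: luxemburg_norm_le; first by rewrite mulr_gt0// addr_gt0// mulr_gt0.
    rewrite (_ : (fun _ => _) = (fun w => x w / k / (1 + u * l))).
      exact: modular_truncation_le1.
    by apply/funext => w; rewrite invfM mulrA.
  by rewrite ler_pdivrMr// lerBlDl ler_pdivrMr// mulrC (mulrC l).
rewrite ler_pdivrMr// lerBlDl ler_pdivrMr//.
by rewrite mulrC (mulrC _ u) leNgt Nx.
Qed.

End luxemburg_theory.

(** * Lower bound for the modular *)

Theorem theorem2 (R : realType) (d : measure_display) (T : measurableType d)
    (mu : {finite_measure set T -> \bar R}) (mu_cont : continuous_measure mu)
    (M : R -> R) (M_N : N_function M)
    (phi : R -> R -> R)
    (phi_gt0 : forall l u : R, 1 <= l -> 0 < u -> 0 < phi l u)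
    (phi_homo1 : forall l l' u : R, 1 <= l -> l <= l' -> 0 < u ->
      phi l u <= phi l' u)
    (phi_homo2 : forall l u u' : R, 1 <= l -> 0 < u -> u <= u' ->
      phi l u <= phi l u')
    (phi_M : forall l u : R, 1 <= l -> 0 < u -> phi l u * M u <= M (l * u)) :
  forall r : R, 1 < r ->
  forall x : T -> R, x \in orlicz_space mu M ->
    r <= luxemburg_norm mu M x ->
    ((phi (luxemburg_norm mu M x / r)
          ((r - 1) / (r * luxemburg_norm mu M (cst 1))))%:E
      <= modular mu M x)%E.
Proof.
move=> r r1 x; rewrite inE => -[mx _] rN.
set N := luxemburg_norm mu M x in rN *; set c := luxemburg_norm mu M (cst 1).
have r0 : 0 < r by lra.
have N0 : 0 < N by lra.
have mu0 := luxemburg_norm_gt0_measure M_N mx N0.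
have c0 : 0 < c by exact: luxemburg_norm_cst1_gt0.
set l := N / r; set u := (r - 1) / (r * c).
have l1 : 1 <= l by rewrite ler_pdivlMr// mul1r.
have l0 : 0 < l by lra.
have u0 : 0 < u by rewrite divr_gt0 ?mulr_gt0//; lra.
have phi0 := phi_gt0 l u l1 u0.
pose y1 := truncation u (fun w => x w / l).
have y1_gt1 : (1 < modular mu M y1)%E.
  apply: modular_truncation_gt1 => //.
  (* [l * r = N], so this is [1 + u * c < r], where [u * c = (r - 1) / r]. *)
  have -> : luxemburg_norm mu M x = l * r by rewrite divfK// gt_eqF.
  rewrite ltr_pM2l// -ltrBrDl.
  have -> : u * luxemburg_norm mu M (cst 1) = (r - 1) / r.
    by rewrite /u invfM mulrA divfK// gt_eqF.
  by rewrite ltr_pdivrMr// ltr_pMr//; lra.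
have my1 : measurable_fun setT y1.
  by apply: measurable_truncation; exact: measurable_funM.
have mMy1 := measurable_N_function_norm M_N my1.
have M0 (a : R) : 0 <= M `|a| by exact: (N_function_ge0 M_N).
have le_pt w : phi l u * M `|y1 w| <= M `|x w|.
  rewrite /y1 /truncation; case: ifPn => [uy|_]; last first.
    by rewrite normr0 (N_function0 M_N) mulr0.
  have y0 := lt_le_trans u0 uy.
  have xE : `|x w| = l * `|x w / l|.
    by rewrite normrM (gtr0_norm (x := l^-1)) ?invr_gt0// mulrC divfK ?gt_eqF.
  rewrite [in leRHS]xE; apply: le_trans (phi_M l _ l1 y0).
  by rewrite ler_wpM2r//; exact: phi_homo2.
apply: (@le_trans _ _ ((phi l u)%:E * modular mu M y1)%E).
  by rewrite lee_pemulr ?lee_fin ?(ltW phi0)// ltW.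
rewrite /modular -ge0_integralZl//; last 2 first.
- by move=> w _; rewrite lee_fin.
- by rewrite lee_fin ltW.
apply: ge0_le_integral => //.
- by move=> w _; rewrite lee_fin mulr_ge0// ltW.
- exact: measurable_funeM.
- exact: measurable_N_function_norm.
- by move=> w _; rewrite -EFinM lee_fin.
Qed.
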